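(* Let $T$ be a complete metric tree, embedded isometrically into a Banach space $X$ (and identified with its image), and let $A$ be a bounded (nonempty) subset of $T$. Then $$\lim_{n\to\infty}\delta_n(A,X)=\lim_{n\to\infty}\delta_n^{(a)}(A,X)=\frac{\alpha(A)}{2}.$$
   Context: A metric segment $[x,y]$ in a metric space is the image of an isometric embedding $\gamma:[a,b]\to M$ of a real interval with $\gamma(a)=x$, $\gamma(b)=y$. A metric space $T$ is a metric tree if for all $x,y,z\in T$: (1) there is a unique metric segment $[x,y]$ from $x$ to $y$, and (2) $[x,z]\cap[z,y]=\{z\}$ implies $[x,z]\cup[z,y]=[x,y]$. For a subset $A$ of a normed space $X$ and $n\ge 0$, $\delta_n(A,X)=\inf_M \sup_{a\in A} d(a,M)$, the infimum running over linear subspaces $M\subset X$ of dimension at most $n$; $\delta_n^{(a)}(A,X)$ is defined in the same way with (nonempty) affine subspaces $M$ of dimension at most $n$. The set measure of non-compactness is $\alpha(A)=\inf\{a>0 : A\subset\bigcup_{j=1}^k A_j\text{ for some }k\in\mathbb{N}\text{ and some }A_j\subset A\text{ with }\operatorname{diam}(A_j)\le a\}$. *)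

(* Defs.v *)
From HB Require Import structures.
From mathcomp Require Export all_boot all_order all_algebra.
From mathcomp Require Export all_classical all_reals all_analysis.
Export numFieldNormedType.Exports.

Set Implicit Arguments.
Unset Strict Implicit.
Unset Printing Implicit Defensive.

Import Order.TTheory GRing.Theory Num.Theory.

Local Open Scope classical_set_scope.
Local Open Scope ring_scope.
Local Open Scope ereal_scope.

#[short(type="completeMetricType")]
HB.structure Definition CompleteMetric (R : numDomainType) :=
  {T of Complete T & Metric R T}.

Section metric_trees.
Context {R : realType} {T : metricType R}.
Implicit Types (x y z : T) (S A : set T).

(* S = [x, y]; only the values of g on `[a, b] matter. *)
Definition is_metric_segment x y S : Prop :=
  exists (a b : R) (g : R -> T),
    [/\ (a <= b)%R,
        {in `[a, b] &, forall s t, mdist (g s) (g t) = `|s - t|%R},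
        g a = x, g b = y & S = g @` `[a, b]].

(* diam set0 = -oo, so empty pieces are harmless in set_mnc. *)
Definition diam A : \bar R := ereal_sup [set (mdist x y)%:E | x in A & y in A].

(* The set measure of non-compactness alpha(A). *)
Definition set_mnc A : \bar R :=
  ereal_inf [set a%:E | a in [set a : R | (0 < a)%R /\
    exists (k : nat) (B : 'I_k -> set T),
      [/\ forall j, B j `<=` A,
          forall j, diam (B j) <= a%:E
        & A `<=` \bigcup_j B j]]].

End metric_trees.

Definition is_metric_tree {R : realType} (T : metricType R) : Prop :=
  (forall x y : T, exists! S, is_metric_segment x y S) /\
  (forall (x y z : T) (Sxz Szy Sxy : set T),
    is_metric_segment x z Sxz -> is_metric_segment z y Szy ->
    is_metric_segment x y Sxy ->
    Sxz `&` Szy = [set z] -> Sxz `|` Szy = Sxy).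

Section widths.
Context {R : realType} {X : normedModType R}.
Implicit Types (A L M : set X) (n : nat).

Definition is_basis (d : nat) (b : 'I_d -> X) L : Prop :=
  (forall c : 'I_d -> R, \sum_i c i *: b i = 0 -> forall i, c i = 0)%R /\
  L = range (fun c : 'I_d -> R => \sum_i c i *: b i)%R.

Definition is_subspace_dim_le n L : Prop :=
  submod_closed (mem L) /\
  exists (d : nat) (b : 'I_d -> X), (d <= n)%N /\ is_basis b L.

Definition is_affine_dim_le n M : Prop :=
  exists (p : X) (L : set X),
    is_subspace_dim_le n L /\ M = [set (p + v)%R | v in L].

Definition deviation A M : \bar R := ereal_sup [set edist_inf M a | a in A].

(* The Kolmogorov widths delta_n(A, X) and delta_n^(a)(A, X), in \bar R. *)
Definition linear_width n A : \bar R :=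
  ereal_inf [set deviation A M | M in is_subspace_dim_le n].

Definition affine_width n A : \bar R :=
  ereal_inf [set deviation A M | M in is_affine_dim_le n].

End widths.

(* Main.v *)
(* In a metric tree a set of diameter d lies in balls of radius d/2 + e, centred
   at the midpoint of two almost farthest points. Hence if A is covered by k sets
   of diameter <= a, the span of the k centres of these sets is within about a/2
   of A, and delta_n <= alpha/2 + e for large n. Conversely, if A is within r of
   an affine subspace M of finite dimension, the relevant bounded part of M has a
   finite e-net, so A is covered by finitely many balls of radius r + e, and
   alpha <= 2r; thus alpha/2 <= delta_n^(a) <= delta_n for every n. *)

Require Import Defs.
From mathcomp Require Import lra.

Set Implicit Arguments.
Unset Strict Implicit.
Unset Printing Implicit Defensive.

Import Order.TTheory GRing.Theory Num.Theory.

Local Open Scope classical_set_scope.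
Local Open Scope ring_scope.

(** * Midpoints and centres in metric trees *)

Section tree_midpoints.
Context {R : realType} {T : metricType R}.
Implicit Types (x y z p q : T) (S B : set T).

Lemma metric_segment_between x y S q : is_metric_segment x y S -> S q ->
  mdist x y = mdist x q + mdist q y.
Proof.
move=> [a [b [g [ab gI <- <- ->]]]] [t /= tab <-].
have [aab bab] : a \in `[a, b] /\ b \in `[a, b] by rewrite !in_itv /= !lexx ab.
rewrite !gI//; move: tab; rewrite in_itv/= => /andP[at_ tb].
by rewrite !ler0_norm ?subr_le0//; lra.
Qed.

Lemma metric_segment_endpoints x y S : is_metric_segment x y S -> S x /\ S y.
Proof.
move=> [a [b [g [ab gI <- <- ->]]]].
by split; [exists a|exists b] => //=; rewrite in_itv/= lexx ab.
Qed.

(** The shared endpoint makes the intersection exactly [[set p]], so gluing turns the union into the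
    segment from [x] to [y], and [p] lies on it. *)
Lemma tree_between_of_nearest x p y Sxp Spy : is_metric_tree T ->
  is_metric_segment x p Sxp -> is_metric_segment p y Spy ->
  Sxp `&` Spy `<=` [set p] -> mdist x y = mdist x p + mdist p y.
Proof.
move=> [uniq_seg glue] xp py pI.
have [Sxy [xy _]] := uniq_seg x y.
apply: metric_segment_between (xy) _.
rewrite -(glue _ _ _ _ _ _ xp py xy).
  by left; have [] := metric_segment_endpoints xp.
apply/seteqP; split=> // _ ->; split.
- by have [] := metric_segment_endpoints xp.
- by have [] := metric_segment_endpoints py.
Qed.

(* The projection of z to [x, y] lies on one side of the midpoint m, so m is on
   the geodesic from z to the endpoint on the other side. *)
Lemma tree_midpoint x y : is_metric_tree T ->
  exists m, forall z, mdist z m + mdist x y / 2 <= Num.max (mdist z x) (mdist z y).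
Proof.
move=> treeT; have [uniq_seg _] := treeT.
have [_ [[a [b [g [ab gI <- <- _]]]] _]] := uniq_seg x y.
exists (g ((a + b) / 2)) => z.
(* Continuity of the distance to [z] along the segment yields a closest point [g c], the projection
   of [z]. *)
have : {within `[a, b], continuous (fun t => mdist z (g t))}.
  apply/(@subspace_continuousP _ _ _ (fun t => mdist z (g t) : R^o)) => t tab.
  apply/cvgrPdist_lt => e e0.
  rewrite near_withinE /=; near=> s => sab.
  apply: (@le_lt_trans _ _ `|t - s|); last by near: s; apply: cvgr_dist_lt.
  rewrite -gI ?inE//; last first.
  have := metric_triangle z (g s) (g t); have := metric_triangle z (g t) (g s).
  rewrite (metric_sym (g s)) => h1 h2.
  by rewrite ler_norml; apply/andP; split; lra.
move=> /(EVT_min ab)[c cab cmin].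
(* A point of the segment that lies between [z] and [g c] is at least as far from [z] as [g c],
   hence equals [g c]. This supplies the intersection condition for gluing. *)
have nearest q t : t \in `[a, b] -> q = g t ->
    mdist z (g c) = mdist z q + mdist q (g c) -> q = g c.
  move=> tab qE zqc; apply: mdist_positivity; have /= := cmin _ tab.
  by rewrite -qE; have := mdist_ge0 q (g c); lra.
have [cab1 cab2] : a <= c /\ c <= b by move: cab; rewrite in_itv/= => /andP.
have zy : mdist z (g b) = mdist z (g c) + mdist (g c) (g b).
  have [S [Szc _]] := uniq_seg z (g c).
  apply: (tree_between_of_nearest (Spy := g @` `[c, b]) treeT Szc).
    exists c, b, g; split=> // s t; rewrite !in_itv/= => /andP[? ?] /andP[? ?].
    by apply: gI; rewrite in_itv/=; apply/andP; split; lra.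
  move=> q [Sq [t]]; rewrite /= in_itv/= => /andP[? ?] tq.
  apply: nearest (esym tq) (metric_segment_between Szc Sq).
  by rewrite in_itv/=; apply/andP; split; lra.
have zx : mdist (g a) z = mdist (g a) (g c) + mdist (g c) z.
  have [S [Szc _]] := uniq_seg (g c) z.
  apply: (tree_between_of_nearest (Sxp := g @` `[a, c]) treeT _ Szc).
    exists a, c, g; split=> // s t; rewrite !in_itv/= => /andP[? ?] /andP[? ?].
    by apply: gI; rewrite in_itv/=; apply/andP; split; lra.
  move=> q [[t]]; rewrite /= in_itv/= => /andP[? ?] tq Sq.
  apply: nearest (esym tq) _.
    by rewrite in_itv/=; apply/andP; split; lra.
  have := metric_segment_between Szc Sq.
  by rewrite !(metric_sym _ z) (metric_sym (g c)) addrC.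
have aab : a \in `[a, b] by rewrite in_itv/= lexx ab.
have bab : b \in `[a, b] by rewrite in_itv/= lexx ab.
have mab : (a + b) / 2 \in `[a, b] by rewrite in_itv/=; apply/andP; split; lra.
have := metric_triangle z (g c) (g ((a + b) / 2)).
move: zx zy; rewrite (metric_sym _ z) (metric_sym (g c) z) !gI//.
rewrite (ler0_norm (_ : a - c <= 0)) ?(ler0_norm (_ : c - b <= 0))
  ?(ler0_norm (_ : a - b <= 0)) ?subr_le0// => zx zy.
(* With [m = (a + b) / 2]: if [c <= m], then [(m - c) + (b - a) / 2 = b - c], and the distance from
   [z] to [g b] is the bound; symmetrically for [g a]. *)
rewrite le_max; have [cm|mc] := lerP c ((a + b) / 2).
- move=> h; apply/orP; right; lra.
- move=> h; apply/orP; left; lra.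
Unshelve. all: by end_near. Qed.

Lemma diam_le_mdist B (a : R) x y : (diam B <= a%:E)%E -> B x -> B y ->
  mdist x y <= a.
Proof.
move=> Ba Bx By; rewrite -lee_fin; apply: le_trans Ba.
by apply: ereal_sup_ubound; exists x => //; exists y.
Qed.

(** Let [D = diam B]. For two points of [B] at distance above [D - e], the midpoint is within
    [D - (D - e) / 2 <= a / 2 + e] of every point of [B]. *)
Lemma tree_center B (a e : R) : is_metric_tree T -> B !=set0 ->
  (diam B <= a%:E)%E -> 0 < e ->
  exists c, forall x, B x -> mdist x c <= a / 2 + e.
Proof.
move=> treeT [x0 Bx0] Ba e0.
have D0 : (0 <= diam B)%E.
  apply: ereal_sup_ubound; exists x0 => //; exists x0 => //.
  by rewrite mdistxx.
have Dfin : diam B \is a fin_num by rewrite ge0_fin_numE// (le_lt_trans Ba) ?ltry.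
have [_ [x Bx [y By <-]]] := ub_ereal_sup_adherent e0 Dfin.
rewrite -/(diam B) -(fineK Dfin) -EFinB lte_fin => dxy.
have [m mP] := tree_midpoint x y treeT; exists m => z Bz.
have Bd u v : B u -> B v -> mdist u v <= fine (diam B).
  by apply: diam_le_mdist; rewrite fineK.
have : Num.max (mdist z x) (mdist z y) <= fine (diam B).
  by rewrite ge_max !Bd.
have := mP z; have : fine (diam B) <= a by rewrite -lee_fin fineK.
lra.
Qed.

End tree_midpoints.

(** * Finite nets in bounded parts of finite-dimensional spaces *)

Section finite_nets.
Context {R : realType}.

(** A grid of step [e] starting at [- K] works: [t] is rounded down to it. *)
Lemma interval_net (K e : R) : 0 < e ->
  exists s : seq R, forall t, `|t| <= K -> exists2 u, u \in s & `|t - u| <= e.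
Proof.
move=> e0.
exists [seq i%:R * e - K | i <- iota 0 (Num.truncn (2 * K / e)).+1] => t.
rewrite ler_norml => /andP[Kt tK].
have tK0 : 0 <= (t + K) / e by rewrite divr_ge0 ?(ltW e0)//; lra.
exists ((Num.truncn ((t + K) / e))%:R * e - K).
  apply: (map_f (fun i : nat => i%:R * e - K)).
  rewrite mem_iota/= add0n ltnS le_truncn//.
  by rewrite ler_pM2r ?invr_gt0//; lra.
have /andP[] := truncn_itv tK0.
rewrite ler_pdivlMr// ltr_pdivrMr// -natr1 => h1 h2.
by rewrite ler_norml; apply/andP; split; lra.
Qed.

(* No equivalence of norms is needed: either the first generator is at positive
   distance from the span of the others, which bounds its coefficient, or it is
   a limit of elements of that span and may be discarded. *)
Lemma span_net (X : normedModType R) (d : nat) (b : 'I_d -> X) (r e : R) :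
  0 < e -> exists s : seq X, forall c : 'I_d -> R, `|\sum_i c i *: b i| <= r ->
    exists2 y, y \in s & `|\sum_i c i *: b i - y| <= e.
Proof.
elim: d b r e => [|d IH] b r e e0.
  exists [:: 0] => c _; exists 0; rewrite ?inE// big_ord0 subr0 normr0.
  exact: ltW.
pose b' i := b (lift ord0 i).
have e20 : 0 < e / 2 by rewrite divr_gt0.
have [[D D0 Dv]|/forall2NP nD] := pselect (exists2 D : R, 0 < D &
    forall c : 'I_d -> R, D <= `|b ord0 + \sum_i c i *: b' i|).
(* Once the coefficient of [b ord0] is at most [r / D] in absolute value, the remaining sum has norm
   at most this radius. *)
- have [s1 s1P] := IH b' (r + r / D * `|b ord0|) _ e20.
  (* Adding 1 keeps the divisor positive even when [b ord0 = 0]. *)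
  have v0 : 0 < `|b ord0| + 1 by rewrite ltr_wpDl.
  have [s2 s2P] := interval_net (r / D) (divr_gt0 e20 v0).
  exists [seq t *: b ord0 + y | t <- s2, y <- s1] => c.
  rewrite big_ord_recl; set l := \sum_(i < d) _ => cr.
  (* Factoring out a nonzero [c ord0] leaves a vector of norm at least [D]. *)
  have tr : `|c ord0| <= r / D.
    rewrite ler_pdivlMr//; apply: le_trans cr.
    have [->|c0] := eqVneq (c ord0) 0.
      by rewrite normr0 mul0r.
    have -> : c ord0 *: b ord0 + l =
        c ord0 *: (b ord0 + \sum_i (c (lift ord0 i) / c ord0) *: b' i).
      rewrite scalerDr scaler_sumr; congr (_ + _); apply: eq_bigr => i _.
      by rewrite scalerA mulrC divfK.
    by rewrite normrZ ler_wpM2l.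
  have [|y ys1 ly] := s1P (fun i => c (lift ord0 i)).
    rewrite -/l; have -> : l = (c ord0 *: b ord0 + l) - c ord0 *: b ord0.
      by rewrite addrAC subrr add0r.
    rewrite (le_trans (ler_normB _ _))// lerD// normrZ ler_wpM2r//.
  have [t ts2 ct] := s2P _ tr.
  exists (t *: b ord0 + y); first exact: allpairs_f.
  rewrite opprD addrACA -scalerBl (le_trans (ler_normD _ _))//.
  rewrite (splitr e) lerD// normrZ.
  apply: (@le_trans _ _ (e / 2 / (`|b ord0| + 1) * (`|b ord0| + 1))).
    by rewrite ler_pM// lerDl.
  by rewrite divfK ?gt_eqF.
(* The net is fixed before [c]; the approximation of [b ord0] is chosen afterwards, with an accuracy
   that depends on [c]. *)
- have [s sP] := IH b' (r + e / 2) _ e20.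
  exists s => c; rewrite big_ord_recl; set l := \sum_(i < d) _ => cr.
  have t0 : 0 < `|c ord0| + 1 by rewrite ltr_wpDl.
  have [] := nD (e / 2 / (`|c ord0| + 1)); first by rewrite divr_gt0.
  move=> /existsNP[c' /negP]; rewrite -ltNge => c'P.
  (* Coefficients after replacing [b ord0] by [- \sum_i c' i *: b' i], which moves the vector by at
     most [e / 2]. *)
  pose c2 i := c (lift ord0 i) - c ord0 * c' i.
  have xc2 : `|(c ord0 *: b ord0 + l) - \sum_i c2 i *: b' i| <= e / 2.
    have -> : (c ord0 *: b ord0 + l) - \sum_i c2 i *: b' i =
        c ord0 *: (b ord0 + \sum_i c' i *: b' i).
      rewrite scalerDr scaler_sumr -addrA; congr (_ + _).
      rewrite /l -sumrB; apply: eq_bigr => i _.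
      by rewrite /c2 scalerBl opprB addrCA subrr addr0 scalerA.
    rewrite normrZ.
    apply: (@le_trans _ _ ((`|c ord0| + 1) * (e / 2 / (`|c ord0| + 1)))).
      by rewrite ler_pM// ?lerDl// ltW.
    by rewrite mulrC divfK ?gt_eqF.
  have [|y ys yP] := sP c2.
    set z := \sum_i _ in xc2 *.
    have -> : z = (c ord0 *: b ord0 + l) - ((c ord0 *: b ord0 + l) - z).
      by rewrite subKr.
    by rewrite (le_trans (ler_normB _ _))// lerD.
  exists y => //.
  rewrite (le_trans (ler_distD (\sum_i c2 i *: b' i) _ _))//.
  by rewrite (splitr e) lerD.
Qed.

End finite_nets.

(** * Subspaces through given points, and distances to them *)

Section subspaces.
Context {R : realType} {X : normedModType R}.
Implicit Types (L M : set X) (A : set X).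

Lemma is_basis_submod_closed d (b : 'I_d -> X) L : is_basis b L ->
  submod_closed (mem L).
Proof.
move=> [_ ->]; split=> [|t u v].
  rewrite inE; exists (fun=> 0) => //.
  by rewrite big1// => i _; rewrite scale0r.
rewrite !inE => -[c _ <-] [c' _ <-]; exists (fun i => t * c i + c' i) => //.
rewrite scaler_sumr -big_split; apply: eq_bigr => i _ /=.
by rewrite scalerDl scalerA.
Qed.

(** A basis must be free, so a point is adjoined only if the span built so far misses it. *)
Lemma exists_subspace_containing k (w : 'I_k -> X) :
  exists L, is_subspace_dim_le k L /\ forall i, L (w i).
Proof.
suff [L [d [b [dk bL wL]]]] : exists L d (b : 'I_d -> X),
    [/\ (d <= k)%N, is_basis b L & forall i, L (w i)].
  exists L; split=> //; split; first exact: is_basis_submod_closed bL.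
  by exists d, b.
elim: k w => [|k IH] w.
  pose b (i : 'I_0) : X := 0.
  exists (range (fun c : 'I_0 -> R => \sum_i c i *: b i)), 0, b.
  by split=> //; [split=> // c _ []|case].
have [L [d [b [dk [bfree LE] wL]]]] := IH (fun i => w (lift ord0 i)).
have [Lw0|nLw0] := pselect (L (w ord0)).
  exists L, d, b; split=> //; first exact: leqW.
  by move=> i; case: (unliftP ord0 i) => [j|] ->.
pose b' i := if unlift ord0 i is Some j then b j else w ord0.
have sumb' c : \sum_(i < d.+1) c i *: b' i =
    c ord0 *: w ord0 + \sum_(i < d) c (lift ord0 i) *: b i.
  rewrite big_ord_recl /b' unlift_none; congr (_ + _).
  by apply: eq_bigr => i _; rewrite liftK.
exists (range (fun c : 'I_d.+1 -> R => \sum_i c i *: b' i)), d.+1, b'.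
split=> //; last first.
  move=> i; case: (unliftP ord0 i) => [j|] ->.
    have := wL j; rewrite LE => -[c _ <-].
    exists (fun i => if unlift ord0 i is Some j then c j else 0) => //.
    rewrite sumb' unlift_none scale0r add0r.
    by apply: eq_bigr => i' _; rewrite liftK.
  exists (fun i => if unlift ord0 i is Some j then 0 else 1) => //.
  rewrite sumb' unlift_none scale1r big1 ?addr0// => i' _.
  by rewrite liftK scale0r.
split=> // c; rewrite sumb' => c0.
(* Otherwise solving the relation for [w ord0] would place it in [L]. *)
have c00 : c ord0 = 0.
  apply: contrapT => /eqP c0N; apply: nLw0; rewrite LE.
  exists (fun i => - (c ord0)^-1 * c (lift ord0 i)) => //.
  under eq_bigr do rewrite -scalerA.
  rewrite -scaler_sumr; move/eqP: c0; rewrite addrC addr_eq0 => /eqP ->.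
  by rewrite scaleNr scalerN opprK scalerA mulVf// scale1r.
move: c0; rewrite c00 scale0r add0r => /bfree c0 i.
by case: (unliftP ord0 i) => [j|] ->.
Qed.

Lemma is_subspace_dim_leW m n L : (m <= n)%N ->
  is_subspace_dim_le m L -> is_subspace_dim_le n L.
Proof.
move=> mn [cL [d [b [dm bL]]]]; split=> //.
by exists d, b; split=> //; exact: leq_trans mn.
Qed.

Lemma affine_width_le_linear_width n A :
  (affine_width n A <= linear_width n A)%E.
Proof.
apply: ereal_inf_le_tmp => _ [M Mn <-]; exists M => //.
exists 0, M; split=> //; apply/seteqP; split=> [v Mv|_ [v Mv <-]].
  by exists v; rewrite ?add0r.
by rewrite add0r.
Qed.

(** [edist] is an infimum over radii of open balls, so the non-strict bound is reached through the
    radii [r + e]. *)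
Lemma edist_le (r : R) (x y : X) : `|x - y| <= r -> (edist (x, y) <= r%:E)%E.
Proof.
move=> xyr; apply/lee_addgt0Pr => e e0; rewrite -EFinD.
apply: edist_fin => /=; first by have := normr_ge0 (x - y); lra.
by rewrite -ball_normE /ball_/=; lra.
Qed.

Lemma deviation_le A M (r : R) :
  (forall a, A a -> exists2 m, M m & `|a - m| <= r) -> (deviation A M <= r%:E)%E.
Proof.
move=> AM; apply: ub_ereal_sup => _ [a Aa <-].
have [m Mm am] := AM _ Aa; apply: ge_ereal_inf.
by exists (edist (a, m)); [exists m|exact: edist_le].
Qed.

(** The distance to [M] need not be attained; the strict inequality leaves room for an actual point
    of [M]. *)
Lemma deviation_lt A M (r : R) a : (deviation A M < r%:E)%E -> A a ->
  exists2 m, M m & `|a - m| < r.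
Proof.
move=> AM Aa.
have /ereal_inf_lt[_ [m Mm <-] am] : (edist_inf M a < r%:E)%E.
  by apply: le_lt_trans AM; apply: ereal_sup_ubound; exists a.
by exists m => //; move/edist_lt_ball: am; rewrite -ball_normE.
Qed.

End subspaces.

(** * Comparison of the widths with the measure of non-compactness *)

Section widths_and_mnc.
Context {R : realType} {T : metricType R} {X : normedModType R}.
Context (f : T -> X) (A : set T).
Context (f_isom : forall x y, `|f x - f y| = mdist x y).

Lemma linear_width_le (a e : R) k (B : 'I_k -> set T) n :
  is_metric_tree T -> (forall j, (diam (B j) <= a%:E)%E) ->
  A `<=` \bigcup_j B j -> 0 < e -> (k <= n)%N ->
  (linear_width n (f @` A) <= (a / 2 + e)%:E)%E.
Proof.
move=> treeT Ba AB e0 kn.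
have /choice[w wP] j : exists w, forall x, B j x -> `|f x - w| <= a / 2 + e.
  (* An empty piece has no centre; 0 serves as a default value. *)
  have [->|/set0P Bj0] := eqVneq (B j) set0; first by exists 0.
  have [c cP] := tree_center treeT Bj0 (Ba j) e0.
  by exists (f c) => x Bx; rewrite f_isom cP.
have [L [Lk Lw]] := exists_subspace_containing w.
apply: ge_ereal_inf; exists (deviation (f @` A) L).
  by exists L => //; exact: is_subspace_dim_leW Lk.
apply: deviation_le => _ [x /AB[j _ Bjx] <-].
by exists (w j) => //; exact: wP.
Qed.

Lemma set_mnc_ge0 : (0 <= set_mnc A)%E.
Proof. by apply: le_ereal_inf_tmp => _ [a [a0 _] <-]; rewrite lee_fin ltW. Qed.

(** [A] alone is a cover by one piece; this makes [set_mnc A] finite for bounded [A]. *)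
Lemma set_mnc_le_diam (D : R) : (diam A <= D%:E)%E -> 0 < D ->
  (set_mnc A <= D%:E)%E.
Proof.
move=> AD D0; apply: ge_ereal_inf; exists D%:E => //; exists D => //.
split=> //; exists 1%N, (fun=> A); split=> [_||x Ax]; [exact: subset_refl|by []|].
by exists ord0.
Qed.

Lemma set_mnc_le_affine_deviation n (M : set X) (r C : R) :
  is_affine_dim_le n M -> (deviation (f @` A) M < r%:E)%E -> 0 < r ->
  (forall x, A x -> `|f x| <= C) -> (set_mnc A <= (2 * r)%:E)%E.
Proof.
move=> [p [L [[_ [d [b [_ [_ LE]]]]] ME]]] devr r0 AC.
apply/lee_addgt0Pr => e e0; rewrite -EFinD.
have e20 : 0 < e / 2 by rewrite divr_gt0.
(* If [p + l] in [M] is within [r] of [f x], then [l = f x - (f x - (p + l)) - p] has norm at most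
   this radius. *)
have [s sP] := span_net b (C + r + `|p|) e20.
apply: ge_ereal_inf; exists (2 * r + e)%:E => //; exists (2 * r + e) => //.
split; first lra.
(* Traces on [A] of balls of radius [r + e / 2] around the translated net points; their diameters
   are at most [2 * r + e]. *)
exists (size s), (fun j => A `&` [set x | `|f x - (p + s`_j)| <= r + e / 2]).
split=> [j|j|x Ax]; first exact: subIsetl.
- apply: ub_ereal_sup => _ [x [_ xj] [y [_ yj] <-]].
  rewrite lee_fin -f_isom (le_trans (ler_distD (p + s`_j) _ _))//.
  by move: xj yj => /=; rewrite (distrC (p + _)); lra.
have [m + mr] := deviation_lt devr (imageP f Ax).
rewrite ME LE => -[_ [c _ <-] mE]; rewrite -{m}mE in mr.
have [|y ys yP] := sP c.
  set l := \sum_i _ in mr *.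
  have -> : l = f x - (f x - (p + l)) - p by rewrite subKr addrC addKr.
  rewrite (le_trans (ler_normB _ _))// lerD// (le_trans (ler_normB _ _))//.
  by rewrite lerD ?AC// ltW.
have ks : (index y s < size s)%N by rewrite index_mem.
exists (Ordinal ks) => //; split=> //=; rewrite nth_index//.
set l := \sum_i _ in mr yP.
rewrite (le_trans (ler_distD (p + l) _ _))// lerD ?(ltW mr)//.
by rewrite opprD addrACA subrr add0r.
Qed.

Lemma set_mnc_le_affine_width n : A !=set0 -> (diam A < +oo)%E ->
  (set_mnc A / 2%:E <= affine_width n (f @` A))%E.
Proof.
move=> [x0 Ax0] Afin.
have [D AD] : exists D : R, (diam A <= D%:E)%E.
  by case: (diam A) Afin => [D _|//|_]; [exists D|exists 0; rewrite leNye].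
apply: le_ereal_inf_tmp => _ [M Mn <-].
rewrite inver pnatr_eq0/= lee_pdivrMr//.
have dev0 : (0 <= deviation (f @` A) M)%E.
  apply: le_trans (edist_inf_ge0 M (f x0)) _.
  by apply: ereal_sup_ubound; exists (f x0).
case devE: (deviation _ _) dev0 => [r| |//]; last first.
  by move=> _; rewrite mulyr gtr0_sg// mul1e leey.
rewrite lee_fin -EFinM => r0.
apply/lee_addgt0Pr => e e0; rewrite -EFinD.
(* Enlarging [r] by [e / 2] makes the deviation bound strict, and the radius positive even if
   [r = 0]. *)
have -> : r * 2 + e = 2 * (r + e / 2) by lra.
apply: (@set_mnc_le_affine_deviation n M _ (`|f x0| + D)) => //.
- by rewrite devE lte_fin; lra.
- by lra.
move=> x Ax; have := ler_normD (f x - f x0) (f x0); rewrite subrK f_isom.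
by have := diam_le_mdist AD Ax Ax0; lra.
Qed.

End widths_and_mnc.

(** * Convergence of both widths *)

Lemma cvge_of_lower_bound {R : realType} (u : nat -> \bar R) (l : \bar R) :
  l \is a fin_num -> (forall n, (l <= u n)%E) ->
  (forall e : R, 0 < e -> \forall n \near \oo, (u n <= l + e%:E)%E) ->
  u n @[n --> \oo] --> l.
Proof.
case: l => [l| |]// _ lu ul.
(* Eventually [u n] lies between [l] and [l + 1], so convergence can be tested on real values. *)
have ufin : \forall n \near \oo, u n \is a fin_num.
  apply: filterS (ul 1 ltr01) => n un.
  by rewrite fin_real// (lt_le_trans _ (lu n)) ?ltNyr//= (le_lt_trans un) ?ltry.
apply/fine_cvgP; split=> //; apply/cvgrPdist_le => e e0.
near=> n.
have un : u n \is a fin_num by near: n.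
rewrite distrC ger0_norm ?subr_ge0 -?lee_fin ?fineK//.
rewrite EFinB fineK// leeBlDl//.
by near: n; exact: ul.
Unshelve. all: by end_near. Qed.

Local Open Scope ereal_scope.

Theorem corollary6p10 (R : realType) (T : completeMetricType R)
    (X : completeNormedModType R) (f : T -> X) (A : set T) :
  is_metric_tree T ->
  (forall x y : T, `|f x - f y|%R = mdist x y) ->
  A !=set0 ->
  diam A < +oo ->
  linear_width n (f @` A) @[n --> \oo] --> set_mnc A / 2%:E /\
  affine_width n (f @` A) @[n --> \oo] --> set_mnc A / 2%:E.
Proof.
move=> treeT f_isom A0 Afin.
have lower n := set_mnc_le_affine_width f_isom n A0 Afin.
have mfin : set_mnc A \is a fin_num.
  rewrite ge0_fin_numE ?set_mnc_ge0//.
  have [D D0 AD] : exists2 D : R, (0 < D)%R & diam A <= D%:E.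
    case: (diam A) Afin => [D _|//|_]; last by exists 1%R; rewrite ?leNye.
    by exists (`|D| + 1)%R; rewrite ?ltr_wpDl// lee_fin ler_wpDr// ler_norm.
  by rewrite (le_lt_trans (set_mnc_le_diam AD D0))// ltry.
have lfin : set_mnc A / 2%:E \is a fin_num.
  by rewrite -(fineK mfin) inver pnatr_eq0.
have upper e : (0 < e)%R ->
    \forall n \near \oo, linear_width n (f @` A) <= set_mnc A / 2%:E + e%:E.
  move=> e0.
  (* One cover by [k] pieces of diameter at most [a < set_mnc A + e] serves every [n >= k], with the
     bound [a / 2 + e / 2]. *)
  have [_ [a [a0 [k [B [_ Ba AB]]]] <-]] := lb_ereal_inf_adherent e0 mfin.
  rewrite -/(set_mnc A) => ae.
  exists k => // n /= kn.
  have e20 : (0 < e / 2)%R by rewrite divr_gt0.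
  apply: le_trans (linear_width_le f_isom treeT Ba AB e20 kn) _.
  move: ae; rewrite -(fineK mfin) inver pnatr_eq0/= -EFinM -!EFinD.
  by rewrite lte_fin lee_fin; lra.
(* The affine width is at most the linear one, so it inherits the bound from above and passes on the
   bound from below. *)
split; apply: cvge_of_lower_bound => //.
- by move=> n; exact: le_trans (lower n) (affine_width_le_linear_width _ _).
- move=> e e0; apply: filterS (upper e e0) => n; apply: le_trans.
  exact: affine_width_le_linear_width.
Qed.
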